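(* Let $\mathfrak{X}=(X,\{R_r\}_{r=0}^d)$ be a $P$-polynomial association scheme with base vertex $u_0$ and Terwilliger algebra $T=T(u_0)$. Let $e,r_1,\dots,r_p$ be integers with $p-1\le e\le r_1<r_2<\cdots<r_p\le d$. Suppose that every irreducible $T$-module $W$ with endpoint $\rho(W)\le e$ is thin and satisfies $\rho(W)+\delta(W)\ge r_p$. If the $p\times p$ matrix whose $(i,h)$ entry ($i=1,\dots,p$, $h=0,1,\dots,p-1$) is \[ \prod_{s=1}^{h} c_{r_i-e+p-s}\qquad(\text{the empty product for } h=0 \text{ being } 1), \] i.e. whose $i$-th row is $\big(1,\ c_{r_i-e+p-1},\ c_{r_i-e+p-1}c_{r_i-e+p-2},\ \dots,\ c_{r_i-e+p-1}\cdots c_{r_i-e+1}\big)$, is nonsingular, then, with $S=X_{r_1}\cup X_{r_2}\cup\cdots\cup X_{r_p}$, \[ \dim\big(\mathrm{Hom}_0(S)+\mathrm{Hom}_1(S)+\cdots+\mathrm{Hom}_e(S)\big)=k_e+k_{e-1}+\cdots+k_{e-p+1}. \]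
   Context: $\mathfrak{X}$ is a symmetric $d$-class association scheme on the finite set $X$ which is $P$-polynomial with respect to the ordering $R_0,\dots,R_d$: $(X,R_1)$ is a distance-regular graph and $R_i$ is its distance-$i$ relation. $A_i$ is the adjacency matrix of $R_i$, $E_0,\dots,E_d$ the primitive idempotents of the Bose–Mesner algebra. Intersection numbers: $c_i=p^i_{1,i-1}$ ($i=1,\dots,d$). Shells: $X_r=\{x : (u_0,x)\in R_r\}$, $k_r=|X_r|$. For $z\in X_j$, $f_z\in\mathcal{F}(X)$ (real functions on $X$) is defined by $f_z(x)=1$ if $x\in X_i$ with $i\ge j$ and $(x,z)\in R_{i-j}$, and $0$ otherwise; $\mathrm{Hom}_j(X)=\mathrm{span}\{f_z: z\in X_j\}$, and for $S\subseteq X$, $\mathrm{Hom}_j(S)=\{f|_S : f\in\mathrm{Hom}_j(X)\}$ (a space of functions on $S$). Terwilliger algebra: $E_i^*$ is the diagonal matrix with $(E_i^* )_{xx}=(A_i)_{u_0x}$; $T$ is the matrix algebra generated by $A_0,\dots,A_d,E_0^*,\dots,E_d^*$, acting on $\mathbb{C}^X$. A $T$-module is a $T$-invariant subspace of $\mathbb{C}^X$; for an irreducible $T$-module $W$, its endpoint is $\rho(W)=\min\{i: E_i^*W\ne0\}$, its diameter is $\delta(W)=|\{i: E_i^*W\neq 0\}|-1$, and $W$ is thin if $\dim E_i^*W\le 1$ for all $i$. *)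

(* Defs.v *)
From HB Require Import structures.
From mathcomp Require Import all_boot all_order all_algebra.
From mathcomp Require Import reals.
From mathcomp.real_closed Require Import complex.
Set Implicit Arguments. Unset Strict Implicit. Unset Printing Implicit Defensive.
Import Order.TTheory GRing.Theory Num.Theory.
Local Open Scope ring_scope.

(* Association schemes.  A symmetric d-class association scheme on the
   finite set X is encoded by its "class function" Rel : X -> X -> nat,
   (x,y) \in R_i  <->  Rel x y = i.                                     *)

Definition walk (X : finType) (adj : rel X) (x y : X) (n : nat) : Prop :=
  exists s : seq X, [/\ size s = n, path adj x s & last x s = y].

Definition is_dist (X : finType) (adj : rel X) (x y : X) (n : nat) : Prop :=
  walk adj x y n /\ (forall m, (m < n)%N -> ~ walk adj x y m).

Definition symmetric_scheme (X : finType) (d : nat) (Rel : X -> X -> nat) : Prop :=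
  [/\ (forall x y, (Rel x y <= d)%N),
      (forall i, (i <= d)%N -> exists x y, Rel x y = i),
      (forall x y, (Rel x y == 0%N) = (x == y)),
      (forall x y, Rel x y = Rel y x) &
      (forall h i j (x y x' y' : X), Rel x y = h -> Rel x' y' = h ->
          #|[set z | (Rel x z == i) && (Rel z y == j)]|
          = #|[set z | (Rel x' z == i) && (Rel z y' == j)]|)].

Definition P_polynomial_scheme (X : finType) (d : nat) (Rel : X -> X -> nat) : Prop :=
  symmetric_scheme d Rel /\
  (forall x y, is_dist (fun u v => Rel u v == 1%N) x y (Rel x y)).

Definition shell (X : finType) (Rel : X -> X -> nat) (u0 : X) (r : nat) : {set X} :=
  [set x | Rel u0 x == r].
Definition kk (X : finType) (Rel : X -> X -> nat) (u0 : X) (r : nat) : nat :=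
  #|shell Rel u0 r|.

(* intersection number c_i = p^i_{1,i-1}, computed at a pair (u0,y) with
   (u0,y) \in R_i (well defined by the scheme axioms; 0 if R_i is empty) *)
Definition cc (X : finType) (Rel : X -> X -> nat) (u0 : X) (i : nat) : nat :=
  match [pick y | Rel u0 y == i] with
  | Some y => #|[set z | (Rel u0 z == 1%N) && (Rel z y == i.-1)]|
  | None => 0%N
  end.

Definition fz (R : realType) (X : finType) (Rel : X -> X -> nat) (u0 z : X)
  : {ffun X -> R^o} :=
  [ffun x => if (Rel u0 z <= Rel u0 x)%N && (Rel x z == Rel u0 x - Rel u0 z)%N
             then 1 else 0].

Definition HomX (R : realType) (X : finType) (Rel : X -> X -> nat) (u0 : X) (j : nat)
  : {vspace {ffun X -> R^o}} :=
  <<[seq fz R Rel u0 z | z <- enum (shell Rel u0 j)]>>%VS.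

Definition restr (R : realType) (X : finType) (S : {set X}) (f : {ffun X -> R^o})
  : {ffun {x : X | x \in S} -> R^o} := [ffun x => f (val x)].

Lemma restr_is_linear (R : realType) (X : finType) (S : {set X}) :
  linear (@restr R X S).
Proof. by move=> a f g; apply/ffunP => x; rewrite !ffunE. Qed.

HB.instance Definition _ (R : realType) (X : finType) (S : {set X}) :=
  GRing.isLinear.Build R {ffun X -> R^o} {ffun {x : X | x \in S} -> R^o} _
    (@restr R X S) (@restr_is_linear R X S).

Definition HomS (R : realType) (X : finType) (Rel : X -> X -> nat) (u0 : X)
  (S : {set X}) (j : nat) : {vspace {ffun {x : X | x \in S} -> R^o}} :=
  (linfun (@restr R X S) @: HomX R Rel u0 j)%VS.

(* The Terwilliger algebra and its modules, acting on C^X, C = R[i].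
   Vectors of C^X are indexed through enum_val : 'I_#|X| -> X; a subspace
   of C^X is the column space of W^T, i.e. the row space of a matrix W
   (rows = vectors).  M acts on a vector v (as a column) by M v, i.e. on
   rows by v^T M^T.                                                     *)

Definition Amx (R : realType) (X : finType) (Rel : X -> X -> nat) (i : nat)
  : 'M[R[i]]_#|X| :=
  \matrix_(a, b) ((Rel (enum_val a) (enum_val b) == i)%:R).

Definition Esmx (R : realType) (X : finType) (Rel : X -> X -> nat) (u0 : X) (i : nat)
  : 'M[R[i]]_#|X| :=
  \matrix_(a, b) (((a == b) && (Rel u0 (enum_val a) == i))%:R).

(* W is a T-module: invariant under the generators A_0..A_d, E*_0..E*_d
   of T (hence under the algebra T they generate). *)
Definition Tmodule (R : realType) (X : finType) (d : nat) (Rel : X -> X -> nat)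
  (u0 : X) m (W : 'M[R[i]]_(m, #|X|)) : Prop :=
  forall i, (i <= d)%N ->
    stablemx W (Amx R Rel i)^T /\ stablemx W (Esmx R Rel u0 i)^T.

Definition irreducible_Tmodule (R : realType) (X : finType) (d : nat)
  (Rel : X -> X -> nat) (u0 : X) m (W : 'M[R[i]]_(m, #|X|)) : Prop :=
  [/\ Tmodule d Rel u0 W, W != 0 &
      forall m' (U : 'M[R[i]]_(m', #|X|)), Tmodule d Rel u0 U ->
        (U <= W)%MS -> U = 0 \/ (U == W)%MS].

Definition dimEsW (R : realType) (X : finType) (Rel : X -> X -> nat) (u0 : X)
  m (W : 'M[R[i]]_(m, #|X|)) (i : nat) : nat :=
  \rank (W *m (Esmx R Rel u0 i)^T).

(* endpoint rho(W) = min { i : E*_i W <> 0 } (for W irreducible, such i <= d exists) *)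
Definition endpoint (R : realType) (X : finType) (d : nat) (Rel : X -> X -> nat)
  (u0 : X) m (W : 'M[R[i]]_(m, #|X|)) (rho : nat) : Prop :=
  [/\ (rho <= d)%N, (dimEsW Rel u0 W rho != 0)%N &
      forall i, (i < rho)%N -> dimEsW Rel u0 W i = 0%N].

Definition Tdiameter (R : realType) (X : finType) (d : nat) (Rel : X -> X -> nat)
  (u0 : X) m (W : 'M[R[i]]_(m, #|X|)) : nat :=
  (#|[set i : 'I_d.+1 | dimEsW Rel u0 W i != 0%N]|).-1.

Definition thin (R : realType) (X : finType) (d : nat) (Rel : X -> X -> nat)
  (u0 : X) m (W : 'M[R[i]]_(m, #|X|)) : Prop :=
  forall i, (i <= d)%N -> (dimEsW Rel u0 W i <= 1)%N.

(* Main.v *)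
(** Let [V_j] be the space of functions supported on the shell [X_j], and let
    [Ra] be the raising part of [A_1], mapping [V_j] to [V_(j+1)].  Counting
    geodesics, [f_z] on [X_(j+n)] is [Ra^n e_z / (c_1 ... c_n)], so an element
    of [Hom_j(S)] is a family [(Ra^(r_i-j) v / (c_1 ... c_(r_i-j)))_i] with
    [v] in [V_j].  Up to a scaling of its rows, the given matrix is
    [B = (1 / (c_1 ... c_(r_i-j)))_(i, j)] with [e-p < j <= e].

    Upper bound: for [l <= e-p], writing [1 / (c_1 ... c_(r_i-l))] as a
    combination of the columns of [B] expresses the elements of [Hom_l(S)]
    coming from [v] through the [Ra^(j-l) v], hence inside the sum of the
    [Hom_j(S)] with [e-p < j <= e].

    Lower bound: a relation [sum_j Ra^(r_i-j) u_j / (c_1 ... c_(r_i-j)) = 0]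
    for all [i] becomes, after applying [Ra^(r_p-r_i)], a linear system with
    matrix [B] in the vectors [Ra^(r_p-j) u_j]; hence these vanish.  Finally
    [Ra^(r_p-j)] is injective on [V_j] for [j <= e]: by complete reducibility
    this may be checked on irreducible modules, and if raising kills a nonzero
    vector of a thin [W] on shell [i < rho + delta], then the part of [W] on
    shells [<= i] is a proper submodule. *)
Require Import Defs.
From HB Require Import structures.
From mathcomp Require Import all_boot all_order all_algebra.
From mathcomp Require Import zify ring.
From mathcomp Require Import boolp reals.
From mathcomp.real_closed Require Import complex.
Import Order.TTheory GRing.Theory Num.Theory.
Local Open Scope ring_scope.
Set Implicit Arguments. Unset Strict Implicit. Unset Printing Implicit Defensive.

(** * Freeness over a finite index set, and an interval count *)

Lemma free_image (K : fieldType) (V : vectType K) (I : finType) (P : {set I})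
    (f : I -> V) :
  (forall k : I -> K, \sum_(i in P) k i *: f i = 0 -> {in P, forall i, k i = 0}) ->
  free [seq f i | i <- enum P].
Proof.
move=> indep.
have -> : [seq f i | i <- enum P] = [tuple f (enum_val i) | i < #|P|].
  apply: (@eq_from_nth _ 0) => [|i]; first by rewrite size_map -cardE size_tuple.
  rewrite size_map -cardE => lti; rewrite (nth_mktuple _ _ (Ordinal lti)).
  have x0 := enum_val (Ordinal lti).
  by rewrite (nth_map x0) -?cardE // (enum_val_nth x0).
apply/freeP => k k0 i; have iP := enum_valP i.
have := indep (fun x => k (enum_rank_in iP x)) _ _ iP.
rewrite enum_valK_in; apply; rewrite big_enum_val -[RHS]k0.
by apply: eq_bigr => j _; rewrite enum_valK_in nth_mktuple.
Qed.

Lemma card_ord_interval m i n : (#|[set a : 'I_n | m <= a <= i]%N| <= i.+1 - m)%N.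
Proof.
rewrite -(size_iota m (i.+1 - m)) cardE -(size_map val).
apply: uniq_leq_size; first by rewrite map_inj_uniq ?enum_uniq //; exact: val_inj.
move=> _ /mapP[a + ->]; rewrite mem_enum inE mem_iota /= => /andP[l1 l2].
by rewrite l1 /=; lia.
Qed.

(** * Distances and intersection numbers *)

Section Combinatorics.
Variables (X : finType) (d : nat) (Rel : X -> X -> nat) (u0 : X).
Hypothesis sch : P_polynomial_scheme d Rel.

Lemma Rel_le x y : (Rel x y <= d)%N.
Proof. by case: sch => [[]]. Qed.

Lemma Rel_sym x y : Rel x y = Rel y x.
Proof. by case: sch => [[]]. Qed.

Lemma Rel_eq0 x y : (Rel x y == 0%N) = (x == y).
Proof. by case: sch => [[]]. Qed.

Lemma Rel_refl x : Rel x x = 0%N.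
Proof. by apply/eqP; rewrite Rel_eq0. Qed.

Lemma intersection_number i j x y x' y' : Rel x y = Rel x' y' ->
  #|[set z | (Rel x z == i) && (Rel z y == j)]|
  = #|[set z | (Rel x' z == i) && (Rel z y' == j)]|.
Proof. by case: sch => [[_ _ _ _ p] _] exy; exact: (p _ i j _ _ _ _ exy erefl). Qed.

Lemma Rel_le_walk x y n : walk (fun u v => Rel u v == 1%N) x y n -> (Rel x y <= n)%N.
Proof.
move=> w; rewrite leqNgt; apply/negP => lt_n.
by case: sch => _ /(_ x y) [_ /(_ n lt_n)].
Qed.

Lemma Rel_triangle x y z : (Rel x z <= Rel x y + Rel y z)%N.
Proof.
case: (sch) => _ geo; case: (geo x y) => [[s [<- ps <-]] _].
case: (geo (last x s) z) => [[t [<- pt <-]] _].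
by apply: Rel_le_walk; exists (s ++ t); rewrite size_cat cat_path last_cat ps pt.
Qed.

Lemma Rel_step x y n : Rel x y = n.+1 -> exists z, Rel x z = 1%N /\ Rel z y = n.
Proof.
move=> exy; case: (sch) => _ /(_ x y) [[[|z s] []]]; rewrite exy //=.
case=> ss /andP[/eqP xz ps] lasts _; exists z; split=> //.
apply/eqP; rewrite eqn_leq -ss Rel_le_walk; last by exists s.
by rewrite ss -ltnS -exy; have := Rel_triangle x z y; rewrite xz add1n.
Qed.

(** The axioms only provide some pair in [R_i]; the valency of [R_i] is the same at every vertex, so
    it is positive at [u0] as well. *)
Lemma shell_neq0 i : (i <= d)%N -> exists y, Rel u0 y = i.
Proof.
case: (sch) => [[_ occ _ _ _] _] /occ [x [y xy]].
have: (0 < #|[set z | (Rel x z == i) && (Rel z x == i)]|)%N.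
  by apply/card_gt0P; exists y; rewrite inE Rel_sym andbb Rel_sym xy.
rewrite (@intersection_number _ _ _ _ u0 u0) ?Rel_refl // => /card_gt0P[z].
by rewrite inE => /andP[/eqP]; exists z.
Qed.

(** [cc] counts first steps of geodesics from [u0]; by symmetry, last steps of geodesics between any
    two vertices at that distance are equally many. *)
Lemma ccE n x y : Rel x y = n.+1 ->
  #|[set z | (Rel x z == n) && (Rel z y == 1%N)]| = cc Rel u0 n.+1.
Proof.
move=> exy; rewrite /cc; case: pickP => [w /eqP ew|].
  rewrite [RHS](@intersection_number _ _ _ _ y x) ?(Rel_sym y) ?exy //.
  by apply: eq_card => z; rewrite !inE andbC (Rel_sym z) (Rel_sym x).
have [|w ew] := @shell_neq0 n.+1; first by rewrite -exy Rel_le.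
by move/(_ w); rewrite ew eqxx.
Qed.

Lemma cc_gt0 n : (0 < n <= d)%N -> (0 < cc Rel u0 n)%N.
Proof.
case: n => //= n /shell_neq0[y u0y].
have [z [z1 z2]] := @Rel_step y u0 n (etrans (Rel_sym _ _) u0y).
rewrite -(ccE u0y); apply/card_gt0P; exists z.
by rewrite inE Rel_sym z2 Rel_sym z1 !eqxx.
Qed.

(** * Geodesic counts and raising matrices *)

(** For [n <= d], the number of geodesics joining two vertices at distance [n]. *)
Definition ccfact n := (\prod_(1 <= s < n.+1) cc Rel u0 s)%N.

Lemma ccfactS n : ccfact n.+1 = (ccfact n * cc Rel u0 n.+1)%N.
Proof. by rewrite /ccfact big_nat_recr. Qed.

Lemma ccfact_gt0 n : (n <= d)%N -> (0 < ccfact n)%N.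
Proof.
elim: n => [|n IHn] len; first by rewrite /ccfact big_nil.
by rewrite ccfactS muln_gt0 IHn ?cc_gt0 // ltnW.
Qed.

Lemma ccfact_div m h : (h <= m)%N ->
  ccfact m = (ccfact (m - h) * \prod_(1 <= s < h.+1) cc Rel u0 (m.+1 - s))%N.
Proof.
elim: h => [|h IHh] leh; first by rewrite big_nil muln1 subn0.
rewrite IHh ?(ltnW leh) // [in RHS]big_nat_recr //= subSS -(subnSK leh) ccfactS.
by rewrite -!mulnA; congr (_ * _)%N; rewrite mulnC.
Qed.

(* [geo_mx F n] maps the indicator of [z] (a row) to the indicator of the
   vertices [x], [n] shells above [z], that a geodesic from [u0] reaches
   through [z]; [geo_mx F 1] is the raising part of the adjacency matrix. *)
Definition geo_mx (F : nzRingType) n : 'M[F]_#|X| :=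
  \matrix_(a, b) ((Rel u0 (enum_val b) == Rel u0 (enum_val a) + n)%N
                 && (Rel (enum_val a) (enum_val b) == n))%:R.

Lemma sum_enum_val (V : nmodType) (f : X -> V) :
  \sum_(a < #|X|) f (enum_val a) = \sum_x f x.
Proof.
by rewrite (reindex (@enum_val _ (mem X))) //; exists enum_rank => x _;
  rewrite ?enum_valK ?enum_rankK.
Qed.

Lemma map_geo_mx (F K : nzRingType) (f : {rmorphism F -> K}) n :
  map_mx f (geo_mx F n) = geo_mx K n.
Proof. by apply/matrixP => a b; rewrite !mxE rmorph_nat. Qed.

Lemma geo_mx0 (F : nzRingType) : geo_mx F 0 = 1%:M.
Proof.
apply/matrixP => a b; rewrite !mxE addn0 Rel_eq0 (inj_eq enum_val_inj).
by case: (a =P b) => [->|]; rewrite ?eqxx ?andbF.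
Qed.

(** An entry of the product counts the last-but-one vertices of geodesics from [x] up to [y]: there
    are [c_(n+1)] if [y] lies [n + 1] shells above [x] at distance [n + 1], and none otherwise. *)
Lemma geo_mxS (F : nzRingType) n :
  geo_mx F n *m geo_mx F 1 = (cc Rel u0 n.+1)%:R *: geo_mx F n.+1.
Proof.
apply/matrixP => a b; rewrite !mxE.
under eq_bigr => i _ do rewrite !mxE.
set x := enum_val a; set y := enum_val b.
rewrite (sum_enum_val (fun z =>
  ((Rel u0 z == Rel u0 x + n)%N && (Rel x z == n))%:R *
  ((Rel u0 y == Rel u0 z + 1)%N && (Rel z y == 1%N))%:R)).
under eq_bigr => z _ do rewrite -natrM mulnb -andbA.
rewrite -natr_sum -natrM; congr (_%:R).
have [/andP[/eqP eD /eqP ex]|nE] := boolP (_ && _); last first.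
  rewrite muln0 big1 // => z _.
  apply/eqP; rewrite eqb0; apply/negP.
  move=> /and3P[/eqP e1 /eqP e2 /andP[/eqP e3 /eqP e4]].
  move/negP: nE; apply; have := Rel_triangle x z y; have := Rel_triangle u0 x y; lia.
rewrite muln1 -(ccE ex) -sum1_card big_mkcond [RHS]big_mkcond /=.
apply: eq_bigr => z _; rewrite inE.
have := Rel_triangle u0 x z; have := Rel_triangle u0 z y => tzy txz.
(* The triangle inequalities for [u0, x, z] and [u0, z, y] pin down the shell of [z], so the shell
   conditions are automatic. *)
suff ->: [&& Rel u0 z == Rel u0 x + n, Rel x z == n & (Rel u0 y == Rel u0 z + 1)
             && (Rel z y == 1)]%N = (Rel x z == n) && (Rel z y == 1%N).
  by case: ifP.
apply/idP/idP => [/and3P[_ -> /andP[_ ->]] // | /andP[/eqP exz /eqP ezy]].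
by rewrite exz ezy !eqxx; apply/and3P; split=> //; lia.
Qed.

(** [ccfact n] times [geo_mx F n] is the [n]-th power of the raising matrix. *)
Lemma geo_mxD (F : comNzRingType) m n :
  (ccfact m * ccfact n)%:R *: (geo_mx F m *m geo_mx F n)
  = (ccfact (m + n))%:R *: geo_mx F (m + n).
Proof.
have geoS k : (ccfact k.+1)%:R *: geo_mx F k.+1
            = (ccfact k)%:R *: geo_mx F k *m geo_mx F 1.
  by rewrite -scalemxAl geo_mxS scalerA -natrM -ccfactS.
elim: n => [|n IHn].
  by rewrite geo_mx0 mulmx1 addn0 {2}/ccfact big_nil muln1.
rewrite natrM -scalerA scalemxAr geoS mulmxA -scalemxAr -scalemxAl scalerA -natrM.
by rewrite scalemxAl IHn -geoS addnS.
Qed.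

(** * Modules of the Terwilliger algebra *)

Section TerwilligerModules.
Variable R : realType.
Local Notation A := (Amx R Rel).
Local Notation E := (Esmx R Rel u0).
Local Notation G := (geo_mx R[i]).
Local Notation "B ^!" :=
  (orthomx Num.conj (mx_of_hermitian (hermitian1mx _)) B) : matrix_set_scope.

Lemma Amx_tr i : (A i)^T = A i.
Proof. by apply/matrixP => a b; rewrite !mxE Rel_sym. Qed.

Lemma Esmx_diag i : E i = diag_mx (\row_a (Rel u0 (enum_val a) == i)%:R).
Proof.
by apply/matrixP => a b; rewrite !mxE; case: (a == b).
Qed.

Lemma Esmx_tr i : (E i)^T = E i.
Proof. by rewrite Esmx_diag tr_diag_mx. Qed.

Lemma TmoduleE m (W : 'M[R[i]]_(m, #|X|)) :
  Tmodule d Rel u0 W <->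
  (forall i, (i <= d)%N -> stablemx W (A i) /\ stablemx W (E i)).
Proof. by split=> + i lei => /(_ i lei); rewrite Amx_tr Esmx_tr. Qed.

Lemma Amx0 : A 0 = 1%:M.
Proof.
by apply/matrixP => a b; rewrite !mxE Rel_eq0 (inj_eq enum_val_inj).
Qed.

(** By the triangle inequality no relation beyond [l + 1] occurs. The top coefficient is singled out
    so that the recurrence can be solved for [A l.+1]. *)
Lemma AmxM1 l : exists p : nat -> nat,
  A l *m A 1 = \sum_(h < l.+1) (p h)%:R *: A h + (cc Rel u0 l.+1)%:R *: A l.+1.
Proof.
pose N x y := #|[set z | (Rel x z == l) && (Rel z y == 1%N)]|.
exists (fun h => if [pick y | Rel u0 y == h] is Some y then N u0 y else 0%N).
apply/matrixP => a b; rewrite !mxE summxE.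
set x := enum_val a; set y := enum_val b.
have ->: \sum_j A l a j * A 1 j b = (N x y)%:R.
  under eq_bigr => i _ do rewrite !mxE -natrM mulnb.
  rewrite (sum_enum_val (fun z => ((Rel x z == l) && (Rel z y == 1%N))%:R)).
  rewrite -natr_sum /N -sum1_card [in RHS]big_mkcond /=; congr (_%:R).
  by apply: eq_bigr => z _; rewrite inE; case: ifP.
under eq_bigr => h _ do rewrite !mxE -/x -/y.
case: (ltngtP (Rel x y) l.+1) => [ltl|gtl|eql].
- rewrite mulr0 addr0 (bigD1 (Ordinal ltl)) //= eqxx mulr1 big1 ?addr0.
    case: pickP => [w /eqP ew|]; first by congr (_%:R); exact: intersection_number.
    have [w ew] := shell_neq0 (Rel_le x y).
    by move/(_ w); rewrite ew eqxx.
  by move=> h; rewrite -val_eqE eq_sym /= => /negPf->; rewrite mulr0.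
- rewrite mulr0 addr0 big1 => [|h _]; last first.
    rewrite (_ : (_ == _) = false) ?mulr0 //; apply/eqP => eh.
    by have := ltn_ord h; lia.
  rewrite /N eq_card0 // => z; rewrite !inE; apply/negP => /andP[/eqP e1 /eqP e2].
  by have := Rel_triangle x z y; lia.
- rewrite mulr1 big1 ?add0r => [|h _]; last first.
    rewrite (_ : (_ == _) = false) ?mulr0 //; apply/eqP => eh.
    by have := ltn_ord h; lia.
  by rewrite /N (ccE eql).
Qed.

Lemma stable_Tmodule m (W : 'M[R[i]]_(m, #|X|)) :
  stablemx W (A 1) -> (forall i, (i <= d)%N -> stablemx W (E i)) ->
  Tmodule d Rel u0 W.
Proof.
move=> W1 WE; apply/TmoduleE => i lei; split; last exact: WE.
elim/ltn_ind: i lei => -[_ _|l IHl lel]; first by rewrite Amx0 mulmx1.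
have [p Ap] := AmxM1 l.
have c0 : (cc Rel u0 l.+1)%:R != 0 :> R[i] by rewrite pnatr_eq0 -lt0n cc_gt0.
have -> : A l.+1 = (cc Rel u0 l.+1)%:R^-1 *:
    (A l *m A 1 - \sum_(h < l.+1) (p h)%:R *: A h).
  by rewrite Ap addrC addKr scalerA mulVf // scale1r.
rewrite -scalemxAr scalemx_sub // mulmxBr addmx_sub ?eqmx_opp //.
  rewrite mulmxA; apply: submx_trans (submxMr (A 1) _) W1.
  by apply: IHl => //; apply: ltnW.
rewrite mulmx_sumr summx_sub // => h _.
by rewrite -scalemxAr scalemx_sub // IHl //; have := ltn_ord h; lia.
Qed.

(** A real symmetric matrix is self-adjoint, so it can be moved across the Hermitian product. *)
Lemma stablemx_ortho m (W : 'M[R[i]]_(m, #|X|)) (N : 'M[R[i]]_#|X|) :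
  N^T = N -> map_mx Num.conj N = N -> stablemx W N -> stablemx (W^!)%MS N.
Proof.
move=> Nt Nc /submxP[D DW]; apply/orthomx1P.
have /orthomx1P W0 := submx_refl (W^!)%MS.
rewrite -mulmxA; have -> : N *m map_mx Num.conj W^T = map_mx Num.conj (W *m N)^T.
  by rewrite trmx_mul Nt map_mxM Nc.
by rewrite DW trmx_mul map_mxM mulmxA W0 mul0mx.
Qed.

Lemma Tmodule_ortho m (W : 'M[R[i]]_(m, #|X|)) :
  Tmodule d Rel u0 W -> Tmodule d Rel u0 (W^!)%MS.
Proof.
have realM (b : bool) : Num.conj (b%:R : R[i]) = b%:R by rewrite rmorph_nat.
move=> /TmoduleE TW; apply/TmoduleE => i /TW[WA WE].
split; apply: stablemx_ortho; rewrite ?Amx_tr ?Esmx_tr //.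
all: by apply/matrixP => a b; rewrite !mxE realM.
Qed.

Lemma Tmodule_cap m1 m2 (U : 'M[R[i]]_(m1, #|X|)) (V : 'M[R[i]]_(m2, #|X|)) :
  Tmodule d Rel u0 U -> Tmodule d Rel u0 V -> Tmodule d Rel u0 (U :&: V)%MS.
Proof.
move=> TU TV i lei; have [UA UE] := TU i lei; have [VA VE] := TV i lei.
by split; [apply: submx_trans (capmxMr U V _) (capmxS UA VA)
         | apply: submx_trans (capmxMr U V _) (capmxS UE VE)].
Qed.

(** From shell [i], raising is a block of [A n], hence given by an element of the Terwilliger
    algebra; this is why it preserves modules. *)
Lemma Esmx_Amx_geo_mx i n : E i *m A n *m E (i + n) = E i *m G n.
Proof.
rewrite !Esmx_diag !mul_diag_mx mul_mx_diag; apply/matrixP => a b.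
rewrite !mxE -mulrA; case: (Rel u0 _ =P i) => [<-|]; last by rewrite !mul0r.
by rewrite -natrM mulnb andbC.
Qed.

Lemma mul_geo_mx m (v : 'M[R[i]]_(m, #|X|)) i n : v *m E i = v ->
  v *m G n = v *m A n *m E (i + n).
Proof. by move=> vE; rewrite -{1}vE -!mulmxA -Esmx_Amx_geo_mx -{2}vE -!mulmxA. Qed.

Lemma Esmx_idem i : E i *m E i = E i.
Proof.
rewrite {2 3}Esmx_diag Esmx_diag mul_diag_mx; apply/matrixP => a b; rewrite !mxE.
by case: eqP => _; rewrite ?mul0rn ?mul0r ?mul1r.
Qed.

Lemma mul_geo_mx_shell m (v : 'M[R[i]]_(m, #|X|)) i n : v *m E i = v ->
  v *m G n *m E (i + n) = v *m G n.
Proof. by move=> /mul_geo_mx->; rewrite -!mulmxA Esmx_idem. Qed.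

Lemma mul_geo_mx_sub m m' (W : 'M[R[i]]_(m, #|X|)) (v : 'M[R[i]]_(m', #|X|)) i n :
  Tmodule d Rel u0 W -> (v <= W)%MS -> (i + n <= d)%N -> v *m E i = v ->
  (v *m G n <= W)%MS.
Proof.
move=> /TmoduleE TW vW ind /mul_geo_mx->.
have [[WA _] [_ WE]] := (TW n (leq_trans (leq_addl _ _) ind), TW _ ind).
exact: submx_trans (submxMr _ (submx_trans (submxMr _ vW) WA)) WE.
Qed.

(* Truncation to the shells [0..i]: projecting a T-module onto them gives a
   submodule as soon as raising kills its component on shell [i]. *)
Definition lowmx i : 'M[R[i]]_#|X| :=
  diag_mx (\row_a (Rel u0 (enum_val a) <= i)%:R).

Lemma lowmxE i : lowmx i = \sum_(h < i.+1) E h.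
Proof.
apply/matrixP => a b; rewrite !mxE summxE.
under eq_bigr => h _ do rewrite Esmx_diag !mxE.
case: (a == b); last by rewrite mulr0n big1 // => h _; rewrite mulr0n.
rewrite mulr1n; case: leqP => [le|gt].
  rewrite (bigD1 (Ordinal (le : Rel u0 (enum_val a) < i.+1)%N)) //=.
  rewrite eqxx big1 ?addr0 // => h.
  by rewrite -val_eqE eq_sym /= => /negPf->.
rewrite big1 // => h _; rewrite (_ : (_ == _) = false) //.
by apply/eqP => eh; have := ltn_ord h; lia.
Qed.

Lemma lowmx_Esmx i h : lowmx i *m E h = if (h <= i)%N then E h else 0.
Proof.
rewrite Esmx_diag mul_diag_mx; apply/matrixP => a b.
case: (leqP h i) => [le|gt]; rewrite !mxE; case: (Rel u0 _ =P h) => [->|_];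
  rewrite ?mul0rn ?mulr0 //; first by rewrite le mul1r.
by rewrite leqNgt gt mul0r.
Qed.

(** [A 1] changes the shell by at most one, so the only way out of the shells up to [i] is the
    raising step from shell [i]. *)
Lemma lowmx_Amx i : lowmx i *m A 1 = lowmx i *m A 1 *m lowmx i + E i *m G 1.
Proof.
rewrite Esmx_diag !mul_diag_mx mul_mx_diag; apply/matrixP => a b; rewrite !mxE.
set x := enum_val a; set y := enum_val b.
have := Rel_triangle u0 x y.
case: (Rel x y =P 1%N) => [->|_]; last by rewrite andbF !(mulr0, mul0r) addr0.
rewrite andbT !mulr1 -!natrM !mulnb -natrD => le; congr (_%:R).
by case: (leqP (Rel u0 x) i) => l1; case: (leqP (Rel u0 y) i) => l2;
   case: eqP => e1; case: eqP => e2; rewrite ?mulnb //=; lia.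
Qed.

Lemma lowmx_sub m (W : 'M[R[i]]_(m, #|X|)) i :
  (i <= d)%N -> Tmodule d Rel u0 W -> (W *m lowmx i <= W)%MS.
Proof.
move=> lei /TmoduleE TW; rewrite lowmxE mulmx_sumr summx_sub // => h _.
by case: (TW h) => //; have := ltn_ord h; lia.
Qed.

Lemma lowmx_Tmodule m (W : 'M[R[i]]_(m, #|X|)) i :
  (i < d)%N -> Tmodule d Rel u0 W -> W *m E i *m G 1 = 0 ->
  Tmodule d Rel u0 (W *m lowmx i).
Proof.
move=> lti TW0 W0; have lowW := lowmx_sub (ltnW lti) TW0.
move/TmoduleE: TW0 => TW; have WE h : (h <= d)%N -> (W *m E h <= W)%MS by case/TW.
apply: stable_Tmodule => [|h leh].
  rewrite -mulmxA lowmx_Amx mulmxDr [W *m (E i *m _)]mulmxA W0 addr0 !mulmxA.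
  have [W1 _] := TW 1%N (leq_ltn_trans (leq0n i) lti).
  exact: submxMr (submx_trans (submxMr (A 1) lowW) W1).
by rewrite -mulmxA Esmx_diag diag_mxC mulmxA -Esmx_diag submxMr // WE.
Qed.

Lemma irreducible_geo_mx_neq0 m (W : 'M[R[i]]_(m, #|X|)) rho top v j n :
  irreducible_Tmodule d Rel u0 W -> endpoint d Rel u0 W rho -> thin d Rel u0 W ->
  (top <= rho + Tdiameter d Rel u0 W)%N -> (top <= d)%N -> (j + n <= top)%N ->
  (v <= W)%MS -> v *m E j = v -> v != 0 :> 'rV_#|X| -> v *m G n != 0.
Proof.
move=> [TW W0 irrW] [rhod Wrho Wlow] thinW topW topd + vW vE v0.
elim: n => [|n IHn] len; first by rewrite geo_mx0 mulmx1.
have lti : (j + n < d)%N by lia.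
set i := (j + n)%N in lti; set w := v *m G n.
have w0 : w != 0 by apply: IHn; lia.
have wE : w *m E i = w by apply: mul_geo_mx_shell.
have wW : (w <= W)%MS by apply: (mul_geo_mx_sub TW vW) vE; lia.
apply/eqP => vG0.
have wG0 : w *m G 1 = 0 by rewrite -mulmxA geo_mxS -scalemxAr vG0 scaler0.
have wWE : (w <= W *m E i)%MS by rewrite -wE submxMr.
(* Thinness: the nonzero vector [w] spans the component of [W] on shell [i], so raising kills all of
   that component. *)
have WEw : (W *m E i <= w)%MS.
  rewrite -(mxrank_leqif_sup wWE).2 eqn_leq mxrankS //=.
  have := thinW i (ltnW lti); rewrite /dimEsW Esmx_tr => /leq_trans; apply.
  by rewrite lt0n mxrank_eq0.
have WEi0 : W *m E i != 0.
  by apply: contraNneq w0 => WE0; apply/eqP/(@submx0null _ _ m); rewrite -WE0.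
have WEG0 : W *m E i *m G 1 = 0.
  by have /submxP[D ->] := WEw; rewrite -mulmxA wG0 mulmx0.
(* The truncation keeps the nonzero component on shell [i], so by irreducibility it is all of
   [W]. *)
have [Z|/andP[_ WU]] :=
  irrW _ _ (lowmx_Tmodule lti TW WEG0) (lowmx_sub (ltnW lti) TW).
  have lE : lowmx i *m E i = E i by rewrite lowmx_Esmx leqnn.
  by move: WEi0; rewrite -lE mulmxA Z mul0mx eqxx.
have Whigh h : (i < h)%N -> dimEsW Rel u0 W h = 0%N.
  move=> lth; apply/eqP; rewrite mxrank_eq0 -submx0 Esmx_tr.
  rewrite (submx_trans (submxMr _ WU)) // -mulmxA lowmx_Esmx leqNgt lth /=.
  by rewrite mulmx0 submx0.
have rhoi : (rho <= i)%N by rewrite leqNgt; apply: contraNN Wrho => /Whigh->.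
(* The nonzero shells of [W] lie between [rho] and [i], whereas [i < top]. *)
suff diam : (Tdiameter d Rel u0 W <= i - rho)%N.
  have := leq_trans topW (leq_add (leqnn rho) diam).
  by rewrite subnKC // => le_top; have := leq_trans len le_top; rewrite addnS ltnn.
rewrite /Tdiameter -subn1 leq_subLR add1n.
rewrite -subSn //; apply: leq_trans (card_ord_interval rho i d.+1).
apply: subset_leq_card; apply/subsetP => a; rewrite !inE => Wa.
by rewrite leqNgt [(a <= i)%N]leqNgt; apply/andP; split;
  apply: contraNN Wa; [move/Wlow-> | move/Whigh->].
Qed.

(** Induction on the rank of [W]: a reducible [W] splits into a submodule and its orthogonal
    complement in [W], and raising respects the splitting. *)
Lemma Tmodule_geo_mx_inj (e top : nat) :
  (e <= top <= d)%N ->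
  (forall m (W : 'M[R[i]]_(m, #|X|)) rho, irreducible_Tmodule d Rel u0 W ->
     endpoint d Rel u0 W rho -> (rho <= e)%N ->
     thin d Rel u0 W /\ (top <= rho + Tdiameter d Rel u0 W)%N) ->
  forall m (W : 'M[R[i]]_(m, #|X|)), Tmodule d Rel u0 W ->
  forall (v : 'rV_#|X|) j n, (j <= e)%N -> (j + n <= top)%N ->
  (v <= W)%MS -> v *m E j = v -> v *m G n = 0 -> v = 0.
Proof.
move=> /andP[le_e le_top] thinW m W; move: {2}(\rank W).+1 (ltnSn (\rank W)) => N.
elim: N m W => // N IHN m W rkW TW v j n lej ltn vW vE vG.
have [-> //|/eqP v0] := eqVneq v 0; exfalso.
have [irrW|nirrW] := EM (irreducible_Tmodule d Rel u0 W).
  have Wj : dimEsW Rel u0 W j != 0%N.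
    rewrite mxrank_eq0 Esmx_tr; apply: contra_notN v0 => /eqP WE0.
    by apply: (@submx0null _ _ m); rewrite -WE0 -vE submxMr.
  (* Since [v] lives on shell [j], the endpoint is at most [j <= e], so the hypothesis on modules
     applies. *)
  have [rho Wrho minrho] :=
    ex_minnP (ex_intro (fun j => dimEsW Rel u0 W j != 0%N) j Wj).
  have rhoj : (rho <= j)%N by apply: minrho.
  have endW : endpoint d Rel u0 W rho.
    split=> // [|h lth]; first lia.
    by apply/eqP; apply: contraLR lth => /minrho; rewrite -leqNgt.
  have [thW topW] := thinW _ _ _ irrW endW (leq_trans rhoj lej).
  apply: (negP (irreducible_geo_mx_neq0 irrW endW thW topW le_top ltn vW vE _)).
    exact/eqP.
  exact/eqP.
have W0 : W != 0.
  by apply/eqP => W0; apply: v0; apply: (@submx0null _ _ m); rewrite -W0.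
have [m' [U [TU UW U0 nUW]]] : exists m' (U : 'M[R[i]]_(m', #|X|)),
    [/\ Tmodule d Rel u0 U, (U <= W)%MS, U != 0 & ~~ (W <= U)%MS].
  apply: contra_notP nirrW => nU; split=> // m' U TU UW.
  have [->|U0] := eqVneq U 0; [by left | right]; rewrite UW /=.
  by apply/negPn/negP => nWU; apply: nU; exists m', U.
have rkU : (\rank U < N)%N.
  rewrite -ltnS; apply: leq_trans rkW; rewrite ltnS ltn_neqAle mxrankS // andbT.
  by rewrite (mxrank_leqif_sup UW).2.
set V := (W :&: U^!)%MS.
have TV : Tmodule d Rel u0 V by apply: Tmodule_cap => //; apply: Tmodule_ortho.
have dUV : (U :&: V)%MS = 0.
  by apply/eqP; rewrite -submx0 -(orthomx_ortho_disj U) capmxS ?capmxSr.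
have rkV : (\rank V < N)%N.
  rewrite -ltnS; apply: leq_trans rkW; rewrite ltnS ltn_neqAle.
  rewrite mxrankS ?capmxSl // andbT.
  rewrite (mxrank_leqif_sup (capmxSl _ _)).2; apply: contraNN U0 => WV.
  by rewrite -submx0 -dUV sub_capmx submx_refl (submx_trans UW).
have [a [b [aU bV vab]]] : exists a b : 'rV_#|X|,
    [/\ (a <= U)%MS, (b <= V)%MS & v = a + b].
  have : (v <= U + U^!)%MS by rewrite addsmx_ortho submx1.
  case/sub_addsmxP => -[x y] /= vxy; exists (x *m U), (y *m (U^!)%MS).
  rewrite submxMl sub_capmx submxMl andbT; split=> //.
  have -> : y *m (U^!)%MS = v - x *m U by rewrite vxy addrC addKr.
  by rewrite addmx_sub // eqmx_opp (submx_trans (submxMl _ _)).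
have jd : (j <= d)%N by lia.
(* The projections of [a] and [b] to shell [j] still add up to [v], and they meet the shell
   condition required for raising. *)
have stabE m1 (M : 'M[R[i]]_(m1, #|X|)) (u : 'rV_#|X|) :
    Tmodule d Rel u0 M -> (u <= M)%MS -> (u *m E j <= M)%MS.
  by move=> /TmoduleE /(_ j jd) [_ ME] uM; apply: submx_trans (submxMr _ uM) ME.
have EE (u : 'rV[R[i]]_#|X|) : u *m E j *m E j = u *m E j.
  by rewrite -mulmxA Esmx_idem.
have jnd : (j + n <= d)%N by lia.
have aGU := mul_geo_mx_sub TU (stabE _ _ _ TU aU) jnd (EE a).
have bGV := mul_geo_mx_sub TV (stabE _ _ _ TV bV) jnd (EE b).
have abG : a *m E j *m G n + b *m E j *m G n = 0.
  by rewrite -!mulmxDl -vab vE.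
(* The raised parts have sum zero and lie in [U] and [V], which meet trivially. *)
have aG0 : a *m E j *m G n = 0.
  apply/eqP; rewrite -submx0 -dUV sub_capmx aGU /=.
  by move/eqP: abG; rewrite addr_eq0 => /eqP->; rewrite eqmx_opp.
have bG0 : b *m E j *m G n = 0 by rewrite aG0 add0r in abG.
apply: v0; rewrite -vE vab mulmxDl.
rewrite (IHN _ _ rkU TU _ _ _ lej ltn (stabE _ _ _ TU aU) (EE a) aG0).
by rewrite (IHN _ _ rkV TV _ _ _ lej ltn (stabE _ _ _ TV bV) (EE b) bG0) addr0.
Qed.

End TerwilligerModules.

(** * Hom spaces as raised coefficient vectors *)

Lemma sum_shells (V : nmodType) lo p (F : X -> V) :
  \sum_(y | (lo <= Rel u0 y < lo + p)%N) F y
  = \sum_(h < p) \sum_(y | (Rel u0 y == lo + h)%N) F y.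
Proof.
rewrite [RHS](exchange_big_dep (fun y => lo <= Rel u0 y < lo + p)%N) /=; last first.
  by move=> h y _ /eqP->; rewrite leq_addr ltn_add2l ltn_ord.
apply: eq_bigr => y /andP[lo_y y_hi].
have lt_p : (Rel u0 y - lo < p)%N by rewrite ltn_subLR.
rewrite (big_pred1 (Ordinal lt_p)) // => h.
by rewrite /= -[h == _]val_eqE /= -[in RHS](eqn_add2l lo) subnKC // eq_sym.
Qed.

Section HomDimension.
Variable R : realType.
Local Notation G := (geo_mx R).

Lemma fz_geo_mx z x : (Rel u0 z <= Rel u0 x)%N ->
  fz R Rel u0 z x = G (Rel u0 x - Rel u0 z) (enum_rank z) (enum_rank x).
Proof.
move=> le; rewrite ffunE !mxE !enum_rankK subnKC // eqxx le (Rel_sym z) /=.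
by case: eqP.
Qed.

(** Evaluating at [x] a combination of the [f_y] with [y] on shell [j] amounts to raising its
    coefficient vector to the shell of [x]. *)
Lemma mul_geo_mx_fz (v : 'rV[R]_#|X|) j x : (j <= Rel u0 x)%N ->
  (forall a : 'I_#|X|, Rel u0 (enum_val a) != j -> v 0 a = 0) ->
  (v *m G (Rel u0 x - j)) 0 (enum_rank x)
  = \sum_(y | Rel u0 y == j) v 0 (enum_rank y) * fz R Rel u0 y x.
Proof.
move=> lej supp; rewrite mxE.
pose F y := v 0 (enum_rank y) * G (Rel u0 x - j) (enum_rank y) (enum_rank x).
transitivity (\sum_(a < #|X|) F (enum_val a)).
  by apply: eq_bigr => a _; rewrite /F enum_valK.
rewrite sum_enum_val [RHS]big_mkcond; apply: eq_bigr => y _; rewrite /F.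
case: eqP => [yj|/eqP yj]; first by rewrite fz_geo_mx yj.
by rewrite supp ?mul0r // enum_rankK.
Qed.

Lemma geo_mx_supp n z a : Rel u0 (enum_val a) != (Rel u0 z + n)%N ->
  G n (enum_rank z) a = 0.
Proof. by rewrite mxE enum_rankK => /negPf->. Qed.

(** Real vectors are embedded into complex ones, with the whole space as the module. *)
Lemma geo_mx_inj (e top : nat) :
  (e <= top <= d)%N ->
  (forall m (W : 'M[R[i]]_(m, #|X|)) rho, irreducible_Tmodule d Rel u0 W ->
     endpoint d Rel u0 W rho -> (rho <= e)%N ->
     thin d Rel u0 W /\ (top <= rho + Tdiameter d Rel u0 W)%N) ->
  forall (v : 'rV[R]_#|X|) j n, (j <= e)%N -> (j + n <= top)%N ->
  (forall a : 'I_#|X|, Rel u0 (enum_val a) != j -> v 0 a = 0) ->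
  v *m G n = 0 -> v = 0.
Proof.
move=> le_top thinW v j n lej len supp vG.
pose c : {rmorphism R -> R[i]} := real_complex R.
apply: (@map_mx_inj _ _ c); rewrite map_mx0.
apply: (Tmodule_geo_mx_inj le_top thinW (W := 1%:M) _ lej len); rewrite ?submx1 //.
- by move=> i _; split; apply: submx1.
- rewrite Esmx_diag mul_mx_diag; apply/rowP => a; rewrite !mxE.
  by case: eqP => [_|/eqP/supp->]; rewrite ?mulr1 // rmorph0 mul0r.
- by rewrite -(map_geo_mx c) -map_mxM vG map_mx0.
Qed.

Variables (e p : nat) (r : 'I_p -> nat).
Hypotheses (lepe : (p <= e.+1)%N) (r_ge : forall i, (e <= r i)%N)
  (r_le : forall i, (r i <= d)%N).
(** The indices [lo + h] with [h < p] are the last [p] up to [e]; [p <= e.+1] makes the subtraction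
    exact. *)
Let lo := (e.+1 - p)%N.
Let B := \matrix_(i < p, h < p) ((ccfact (r i - (lo + h)))%:R^-1 : R).

Lemma ccfact_neq0 n : (n <= d)%N -> (ccfact n)%:R != 0 :> R.
Proof. by move=> len; rewrite pnatr_eq0 -lt0n ccfact_gt0. Qed.

(** Row [i] of the given matrix is row [i] of [B] scaled by [ccfact (r i - lo)], because
    [r i - lo = r i - e + p - 1]. *)
Lemma inv_ccfact_unitmx :
  (\matrix_(i < p, h < p)
      (\prod_(1 <= s < h.+1) (cc Rel u0 (r i - e + p - s)%N)%:R : R)) \in unitmx ->
  B \in unitmx.
Proof.
set M := (X in X \in unitmx); suff -> : M =
  diag_mx (\row_i (ccfact (r i - lo))%:R) *m B by rewrite unitmx_mul => /andP[].
rewrite mul_diag_mx; apply/matrixP => i h; rewrite !mxE.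
have lth := ltn_ord h; have := r_ge i => ler.
have leh : (h <= r i - lo)%N by rewrite /lo; lia.
rewrite (ccfact_div leh) subnDA natrM mulrAC divff ?mul1r; last first.
  by apply: ccfact_neq0; have := r_le i; lia.
rewrite natr_prod; apply: eq_bigr => s _; congr (cc _ _ _)%:R.
by rewrite /lo; lia.
Qed.

Lemma geo_mxM m n : (m <= d)%N -> (n <= d)%N ->
  G m *m G n = ((ccfact (m + n))%:R / ((ccfact m)%:R * (ccfact n)%:R)) *: G (m + n).
Proof.
move=> lem len; have := geo_mxD R m n.
have nz : (ccfact m * ccfact n)%:R != 0 :> R.
  by rewrite natrM mulf_neq0 ?ccfact_neq0.
move/(congr1 (fun N => (ccfact m * ccfact n)%:R^-1 *: N)).
by rewrite !scalerA mulVf // scale1r natrM mulrC.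
Qed.

Let Y := [set y | (lo <= Rel u0 y < lo + p)%N].

Lemma geo_mx_via h l i : (l <= lo + h)%N -> (h < p)%N ->
  G (lo + h - l) *m G (r i - (lo + h)) = ((ccfact (r i - l))%:R /
    ((ccfact (lo + h - l))%:R * (ccfact (r i - (lo + h)))%:R)) *: G (r i - l).
Proof.
move=> lel lth; have := r_le i; have := r_ge i => er rd.
have lohe : (lo + h <= e)%N by move: lepe; rewrite /lo; lia.
rewrite geo_mxM; [|lia|lia].
by have -> : (lo + h - l + (r i - (lo + h)) = r i - l)%N by lia.
Qed.

(** The coefficients do not depend on [i], so one relation holds on all the shells [r i] at once. *)
Lemma fz_dependence l : B \in unitmx -> (l < lo)%N -> exists a : X -> X -> R,
  forall z x i, Rel u0 z = l -> Rel u0 x = r i ->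
  fz R Rel u0 z x = \sum_(y in Y) a z y * fz R Rel u0 y x.
Proof.
move=> uB ltl.
(* [t] is the column that index [l] would add to [B], and [b] expresses it through the columns of
   [B]. *)
pose t : 'cV[R]_p := \col_i (ccfact (r i - l))%:R^-1; pose b := invmx B *m t.
have Bb : B *m b = t by rewrite mulKVmx.
(* At most one [h] contributes. The factor [ccfact (lo + h - l)] cancels the one that [geo_mx_via]
   puts in the denominator. *)
pose a z y : R := \sum_(h < p | Rel u0 y == (lo + h)%N)
   b h 0 * (ccfact (lo + h - l))%:R * G (lo + h - l) (enum_rank z) (enum_rank y).
exists a => z x i zl xi.
have rd := r_le i; have er := r_ge i.
have lohe (h : 'I_p) : (lo + h <= e)%N.
  by have := ltn_ord h; move: lepe; rewrite /lo; lia.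
have lel (h : 'I_p) : (l <= lo + h)%N by lia.
transitivity (\sum_(h < p) b h 0 * (ccfact (lo + h - l))%:R *
    (G (lo + h - l) *m G (r i - (lo + h))) (enum_rank z) (enum_rank x)).
  under eq_bigr => h _ do rewrite geo_mx_via ?ltn_ord // [X in _ * X]mxE.
  have /matrixP/(_ i 0) := Bb; rewrite [LHS]mxE [RHS]mxE => Bbi.
  rewrite fz_geo_mx zl xi; last by rewrite -zl; lia.
  rewrite -[LHS]mul1r -[X in X * _ = _](@divff _ (ccfact (r i - l))%:R); last first.
    by apply: ccfact_neq0; lia.
  rewrite -Bbi mulr_sumr mulr_suml; apply: eq_bigr => h _.
  rewrite [B i h]mxE; have := lohe h => lohle.
  have nz1 : (ccfact (lo + h - l))%:R != 0 :> R by apply: ccfact_neq0; lia.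
  have nz2 : (ccfact (r i - (lo + h)))%:R != 0 :> R by apply: ccfact_neq0; lia.
  by field; rewrite nz1 nz2.
rewrite (eq_bigl _ _ (fun y => in_set _ y)) sum_shells; apply: eq_bigr => h _.
have -> : (G (lo + h - l) *m G (r i - (lo + h))) (enum_rank z) (enum_rank x) =
    (row (enum_rank z) (G (lo + h - l)) *m G (Rel u0 x - (lo + h))) 0 (enum_rank x).
  by rewrite -row_mul [RHS]mxE xi.
rewrite mul_geo_mx_fz; first last.
- by move=> c; rewrite mxE => nc; rewrite geo_mx_supp // zl subnKC.
- by rewrite xi (leq_trans (lohe h)).
rewrite mulr_sumr; apply: eq_bigr => y /eqP yh.
rewrite /a (big_pred1 h) => [|g]; last first.
  by rewrite /= yh eqn_add2l eq_sym.
by rewrite [row _ _ _ _]mxE mulrA.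
Qed.

Lemma fz_independence (top : nat) : B \in unitmx -> (e <= top <= d)%N ->
  (forall i, r i <= top)%N ->
  (forall (v : 'rV[R]_#|X|) j n, (j <= e)%N -> (j + n <= top)%N ->
    (forall a : 'I_#|X|, Rel u0 (enum_val a) != j -> v 0 a = 0) ->
    v *m G n = 0 -> v = 0) ->
  forall k : X -> R,
  (forall x i, Rel u0 x = r i -> \sum_(y in Y) k y * fz R Rel u0 y x = 0) ->
  {in Y, forall y, k y = 0}.
Proof.
move=> uB /andP[le_top top_d] r_top inj k k0.
pose u h : 'rV[R]_#|X| :=
  \row_a (if Rel u0 (enum_val a) == (lo + h)%N then k (enum_val a) else 0).
have usupp h a : Rel u0 (enum_val a) != (lo + h)%N -> u h 0 a = 0.
  by rewrite mxE => /negPf->.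
have lohe (h : 'I_p) : (lo + h <= e)%N.
  by have := ltn_ord h; move: lepe; rewrite /lo; lia.
have rel i : \sum_(h < p) u h *m G (r i - (lo + h)) = 0.
  apply/rowP => c; rewrite summxE [RHS]mxE -[c]enum_valK.
  set x := enum_val c; have [xi|xi] := eqVneq (Rel u0 x) (r i).
    rewrite -[RHS](k0 x i xi) (eq_bigl _ _ (fun y => in_set _ y)) sum_shells.
    apply: eq_bigr => h _; rewrite -xi mul_geo_mx_fz; first last.
    - exact: usupp.
    - by rewrite xi (leq_trans (lohe h)).
    by apply: eq_bigr => y /eqP yh; rewrite mxE enum_rankK yh eqxx.
  (* Off shell [r i] each summand vanishes, since raising lands on that shell. *)
  apply: big1 => h _; rewrite mxE big1 // => a _.
  rewrite !mxE enum_rankK; case: eqP => [->|_]; last by rewrite mul0r.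
  by rewrite subnKC ?(leq_trans (lohe h)) // (negPf xi) mulr0.
(* This scaling makes relation [i], raised to shell [top] and multiplied by [ccfact (top - r i)],
   have exactly row [i] of [B] as its coefficients. *)
pose w : 'M[R]_(p, #|X|) :=
  \matrix_(h, a) ((ccfact (top - (lo + h)))%:R *: (u h *m G (top - (lo + h)))) 0 a.
have Bw : B *m w = 0.
  apply/row_matrixP => i; rewrite row0 row_mul mulmx_sum_row.
  have := congr1 (fun N => (ccfact (top - r i))%:R *: (N *m G (top - r i))) (rel i).
  rewrite mul0mx scaler0 mulmx_suml scaler_sumr => rel'; rewrite -[RHS]rel'.
  apply: eq_bigr => h _; rewrite -mulmxA geo_mxM; [|have := r_le i; lia|lia].
  have -> : (r i - (lo + h) + (top - r i) = top - (lo + h))%N.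
    by have := lohe h; have := r_top i; have := r_ge i; lia.
  have -> : row h w = (ccfact (top - (lo + h)))%:R *: (u h *m G (top - (lo + h))).
    by apply/rowP => c; rewrite !mxE.
  rewrite -scalemxAr !scalerA !mxE; congr (_ *: _).
  have nz1 : (ccfact (top - r i))%:R != 0 :> R by apply: ccfact_neq0; lia.
  have nz2 : (ccfact (r i - (lo + h)))%:R != 0 :> R.
    by apply: ccfact_neq0; have := r_le i; lia.
  by field; rewrite nz1 nz2.
have w0 : w = 0 by rewrite -(mulKmx uB w) Bw mulmx0.
have uh0 (h : 'I_p) : u h = 0.
  apply: (inj _ (lo + h)%N (top - (lo + h))%N); [exact: lohe| |exact: usupp|].
    by have := lohe h; lia.
  have nz : (ccfact (top - (lo + h)))%:R != 0 :> R by apply: ccfact_neq0; lia.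
  apply: (scalerI nz); rewrite scaler0; apply/rowP => a.
  by have /matrixP/(_ h a) := w0; rewrite !mxE.
move=> y; rewrite inE => /andP[lo_y y_hi].
have lt_p : (Rel u0 y - lo < p)%N by rewrite ltn_subLR.
have /rowP/(_ (enum_rank y)) := uh0 (Ordinal lt_p).
by rewrite !mxE enum_rankK /= subnKC // eqxx.
Qed.

End HomDimension.

End Combinatorics.

(** * Assembly of the dimension formula *)

(* r_1 < ... < r_p are written r 0 < ... < r p.-1 (0-based); row i of the
   matrix (i = 0..p-1) corresponds to r_{i+1}. *)
Theorem theorem2p1 (R : realType) (X : finType) (d : nat) (Rel : X -> X -> nat)
  (u0 : X) (e p : nat) (r : nat -> nat) :
  P_polynomial_scheme d Rel ->
  (0 < p)%N ->
  (p.-1 <= e)%N -> (e <= r 0%N)%N ->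
  (forall i, (i.+1 < p)%N -> (r i < r i.+1)%N) ->
  (r p.-1 <= d)%N ->
  (forall m (W : 'M[R[i]]_(m, #|X|)) (rho : nat),
      irreducible_Tmodule d Rel u0 W -> endpoint d Rel u0 W rho -> (rho <= e)%N ->
      thin d Rel u0 W /\ (r p.-1 <= rho + Tdiameter d Rel u0 W)%N) ->
  (\matrix_(i < p, h < p)
      (\prod_(1 <= s < h.+1) (cc Rel u0 (r i - e + p - s)%N)%:R : R))
    \in unitmx ->
  let S : {set X} := \bigcup_(i < p) shell Rel u0 (r i) in
  \dim (\sum_(j < e.+1) HomS R Rel u0 S j)%VS = (\sum_(j < p) kk Rel u0 (e - j))%N.
Proof.
move=> sch p0 lepe er0 rinc rpd thinW uM S.
have lepe1 : (p <= e.+1)%N by rewrite -(prednK p0).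
have rmono i j : (i <= j)%N -> (j < p)%N -> (r i <= r j)%N.
  elim: j => [|j IHj]; first by rewrite leqn0 => /eqP->.
  rewrite leq_eqVlt => /predU1P[-> //|lij] ltj.
  exact: leq_trans (IHj lij (ltnW ltj)) (ltnW (rinc j ltj)).
have r_top (i : 'I_p) : (r i <= r p.-1)%N.
  by apply: rmono; rewrite -ltnS prednK.
have r_ge (i : 'I_p) : (e <= r i)%N by apply: leq_trans er0 (rmono _ _ _ _).
have r_le i := leq_trans (r_top i) rpd.
have uB := inv_ccfact_unitmx sch lepe1 r_ge r_le uM.
have e_top : (e <= r p.-1 <= d)%N by rewrite rpd (leq_trans er0) ?rmono ?prednK.
set lo := (e.+1 - p)%N in uB; set Y := [set y | (lo <= Rel u0 y < lo + p)%N].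
have lop : (lo + p = e.+1)%N by rewrite subnK.
pose f y := restr S (fz R Rel u0 y).
have inS x : x \in S -> exists i : 'I_p, Rel u0 x = r i.
  by case/bigcupP => i _; rewrite inE => /eqP; exists i.
have HomSE j : HomS R Rel u0 S j = <<[seq f z | z <- enum (shell Rel u0 j)]>>%VS.
  rewrite /HomS /HomX limg_span -map_comp; congr <<_>>%VS.
  by apply: eq_map => z; rewrite /= lfunE.
(* Generators from shells below [lo] are absorbed by [fz_dependence]. *)
have sumE : (\sum_(j < e.+1) HomS R Rel u0 S j)%VS = <<[seq f y | y <- enum Y]>>%VS.
  apply/eqP; rewrite eqEsubv; apply/andP; split.
    apply/subv_sumP => j _; rewrite HomSE; apply/span_subvP => _ /mapP[z + ->].
    rewrite mem_enum inE => /eqP zj; have [loz|zlo] := leqP lo j.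
      by apply/memv_span/map_f; rewrite mem_enum inE zj loz lop ltn_ord.
    have [a fza] := fz_dependence sch lepe1 r_ge r_le uB zlo.
    have -> : f z = \sum_(y in Y) a z y *: f y.
      apply/ffunP => x; rewrite sum_ffunE ffunE; have [i xi] := inS _ (valP x).
      by rewrite (fza z _ i zj xi); apply: eq_bigr => y _; rewrite !ffunE.
    apply: rpred_sum => y yY; apply/rpredZ/memv_span/map_f.
    by rewrite mem_enum.
  apply/span_subvP => _ /mapP[y + ->]; rewrite mem_enum inE lop => /andP[_ ye].
  apply: (subvP (sumv_sup (Ordinal ye) (erefl true) (subvv _))).
  by rewrite HomSE; apply/memv_span/map_f; rewrite mem_enum inE.
have freeY : free [seq f y | y <- enum Y].
  apply: free_image => k k0.
  apply: (fz_independence sch lepe1 r_ge r_le uB e_top r_top).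
    exact (geo_mx_inj sch e_top thinW).
  move=> x i xi; have xS : x \in S by apply/bigcupP; exists i; rewrite ?inE ?xi.
  have /ffunP/(_ (exist _ x xS)) := k0; rewrite sum_ffunE ffunE => kx.
  rewrite -[RHS]kx.
  by apply: eq_bigr => y _; rewrite !ffunE.
rewrite sumE; move: freeY; rewrite /free size_map -cardE => /eqP->.
rewrite -sum1_card (eq_bigl _ _ (fun y => in_set _ y)) sum_shells.
(* Reversing the order turns shell [lo + h] into shell [e - h], as [lo + (p - h.+1) = e - h]. *)
rewrite (reindex_inj rev_ord_inj) /=; apply: eq_bigr => h _.
rewrite sum1_card /kk; apply: eq_card => y; rewrite inE unfold_in.
by congr (_ == _); have := ltn_ord h; rewrite /lo; lia.
Qed.
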